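(* Let $\mu$ be the Hawkins random sieve probability measure on the space $X$ of strictly increasing (finite or infinite) sequences of integers greater than $1$. For $\alpha\in X$ and real $x$ let $\Pi_{X,X+2}(x;\alpha)=\#\{j\le x : j\in\alpha \text{ and } j+2\in\alpha\}$. Then for $\mu$-almost every $\alpha\in X$, $$\Pi_{X,X+2}(x;\alpha)\sim \frac{x}{(\log x)^2}\qquad (x\to\infty).$$
   Context: Hawkins random sieve (Wunderlich's formulation). Let $X$ be the set of all finite (including empty) and infinite strictly increasing sequences of integers greater than $1$, identified with subsets of $\{2,3,4,\ldots\}$. For $\alpha\in X$ and an integer $n\ge 2$ put $\alpha_n=\alpha\cap\{2,3,\ldots,n-1\}$. For integers $2\le a_1<\cdots<a_k<n$ (with $k\ge 0$ and $n\geq 2$), the elementary set $\{a_1,\ldots,a_k;n\}$ is $\{\alpha\in X:\alpha_n=\{a_1,\ldots,a_k\}\}$; for $k=0$ it is written $\{.;n\}$ and consists of all sequences all of whose elements are $\ge n$. The function $\mu$ is defined recursively on elementary sets by (i) $\mu(\{.;2\})=1$; (ii) $\mu(\{a_1,\ldots,a_k,n;n+1\})=\prod_{i=1}^{k}\left(1-\frac1{a_i}\right)\mu(\{a_1,\ldots,a_k;n\})$; (iii) $\mu(\{a_1,\ldots,a_k;n+1\})=\left(1-\prod_{i=1}^{k}\left(1-\frac1{a_i}\right)\right)\mu(\{a_1,\ldots,a_k;n\})$, where an empty product equals $1$. It extends uniquely to a probability measure, also denoted $\mu$, on the $\sigma$-algebra generated by the elementary sets; ''almost every/almost surely'' refers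 to $\mu$. (Informally: given $\alpha_n$, the integer $n$ belongs to $\alpha$ with probability $\prod_{a\in\alpha_n}(1-1/a)$.) Here $f(x)\sim g(x)$ means $f(x)/g(x)\to1$. *)

(* Defs.v *)
From HB Require Import structures.
From mathcomp Require Import all_boot all_order all_algebra finmap.
From mathcomp Require Import all_classical all_reals all_analysis.
Set Implicit Arguments.
Unset Strict Implicit.
Unset Printing Implicit Defensive.
Import Order.TTheory GRing.Theory Num.Theory.
Import numFieldNormedType.Exports.
Local Open Scope classical_set_scope.
Local Open Scope ring_scope.

(* A finite or infinite strictly increasing sequence of integers > 1 is
   identified with its set of terms, an arbitrary subset of {2, 3, ...}. *)
Definition sieve_space : Type :=
  set_type [set alpha : set nat | alpha `<=` [set n | (1 < n)%N]].

HB.instance Definition _ := Choice.on sieve_space.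

Definition sieve_set (alpha : sieve_space) : set nat := val alpha.

Definition sieve_empty : sieve_space :=
  exist _ set0 (mem_set (sub0set [set n | (1 < n)%N])).

HB.instance Definition _ := isPointed.Build sieve_space sieve_empty.

Definition sieve_trunc (alpha : sieve_space) (n : nat) : set nat :=
  sieve_set alpha `&` [set m | (2 <= m < n)%N].

(* [elementary_index s n] says that s = [:: a_1; ...; a_k] with
   2 <= a_1 < ... < a_k < n and n >= 2; s = [::] is the case k = 0. *)
Definition elementary_index (s : seq nat) (n : nat) : bool :=
  [&& (2 <= n)%N, sorted ltn s & all (fun a => (2 <= a < n)%N) s].

Definition elementary_set (s : seq nat) (n : nat) : set sieve_space :=
  [set alpha | sieve_trunc alpha n = [set a | a \in s]].

Definition elementary_sets : set (set sieve_space) :=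
  [set E | exists s n, elementary_index s n /\ E = elementary_set s n].

Notation sieve_measurableType := (g_sigma_algebraType elementary_sets).

Definition sieve_weight (R : realType) (s : seq nat) : R :=
  \prod_(a <- s) (1 - a%:R^-1).

(* Together with the empty set, the elementary sets form a semiring of sets
   generating the sigma-algebra of [sieve_measurableType], so exactly one
   probability measure has this property. *)
Definition is_hawkins_measure (R : realType)
    (mu : probability sieve_measurableType R) : Prop :=
  [/\ mu (elementary_set [::] 2) = 1%E,
      forall (s : seq nat) (n : nat), elementary_index s n ->
        mu (elementary_set (rcons s n) n.+1) =
        ((sieve_weight R s)%:E * mu (elementary_set s n))%E
    & forall (s : seq nat) (n : nat), elementary_index s n ->
        mu (elementary_set s n.+1) =
        ((1 - sieve_weight R s)%:E * mu (elementary_set s n))%E].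

Definition twin_set (R : realType) (alpha : sieve_space) (x : R) : set nat :=
  [set j | [/\ j%:R <= x, sieve_set alpha j & sieve_set alpha (j + 2)%N]].

Lemma finite_twin_set (R : realType) (alpha : sieve_space) (x : R) :
  finite_set (twin_set alpha x).
Proof.
apply: (sub_finite_set (B := `I_(Num.truncn x).+1)); last exact: finite_II.
move=> j [jx _ _] /=; rewrite -(ltr_nat R).
exact: le_lt_trans jx (truncnS_gt _).
Qed.

(* [fset_set] is meaningful here by [finite_twin_set]. *)
Definition twin_count (R : realType) (alpha : sieve_space) (x : R) : nat :=
  #|` fset_set (twin_set alpha x)|.

(* Main.v *)
Require Import Defs.
From HB Require Import structures.
From mathcomp Require Import all_boot all_order all_algebra finmap.
From mathcomp Require Import all_classical all_reals all_analysis.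
From mathcomp Require Import measurable_realfun.
From mathcomp Require Import ring lra.
Set Implicit Arguments.
Unset Strict Implicit.
Unset Printing Implicit Defensive.
Import Order.TTheory GRing.Theory Num.Theory.
Import numFieldNormedType.Exports.
Local Open Scope classical_set_scope.
Local Open Scope ring_scope.

(* Let W_n be the product of 1 - 1/a over the a < n in alpha, and Y_n = 1/W_n.
   Given alpha_n, Y_n increases by Y_n/(n-1) with probability W_n, so
   Y_n - 1 - H_(n-2) is a martingale with bounded second moment (H_k is the
   k-th harmonic number). Summing second moments along n = 2^(j^2) and
   interpolating by monotonicity gives Y_n = ln n + O(sqrt (ln n)) almost
   surely.
   The twin count differs by a bounded amount from sum_n W_n^2 plus the
   martingale with increments (1[n in alpha] - W_n)(1[n-2 in alpha] + W_n).
   These are bounded by 2, so the second moment grows linearly, and along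
   n = j^4 the martingale is almost surely O(n^(3/4)). Finally
   sum_(i < n) W_i^2 ~ n/(ln n)^2 because W is nonincreasing and
   W_m ~ 1/ln n already at m = n/(ln n)^3. *)

(** * The sieve as a chain on finite histories *)

Section HistoryChain.
Variable R : realFieldType.
Implicit Types (h : seq bool) (f g : seq bool -> R) (b : bool) (k n : nat).

(* A history h of size k records, latest bit first, which of the integers
   2, ..., k+1 were sieved in; its next bit concerns k+2. *)
Fixpoint hweight h : R :=
  if h is b :: h' then (if b then 1 - (size h' + 2)%:R^-1 else 1) * hweight h'
  else 1.

(* The mean of f over the random history of size k. *)
Fixpoint hmean k f : R :=
  if k is k'.+1 then
    hmean k' (fun h => hweight h * f (true :: h)
                       + (1 - hweight h) * f (false :: h))
  else f [::].

Lemma hfactor_gt0 h : 0 < 1 - (size h + 2)%:R^-1 :> R.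
Proof.
by rewrite subr_gt0 invf_lt1 ?ltr1n ?ltr0n ?addn2.
Qed.

Lemma hweight_gt0 h : 0 < hweight h.
Proof.
by elim: h => [|[] h IH] //=; rewrite ?ltr01 ?mul1r// mulr_gt0 ?hfactor_gt0.
Qed.

Lemma hweight_cons_le b h : hweight (b :: h) <= hweight h.
Proof.
case: b => /=; last by rewrite mul1r.
by rewrite ler_piMl ?gerBl ?invr_ge0// ltW// hweight_gt0.
Qed.

Lemma hweight_le1 h : hweight h <= 1.
Proof. by elim: h => // b h; apply/le_trans/hweight_cons_le. Qed.

Lemma hmean_le k f g :
  (forall h, size h = k -> f h <= g h) -> hmean k f <= hmean k g.
Proof.
elim: k f g => [|k IH] f g fg /=; first exact: fg.
apply: IH => h hk; apply: lerD; apply: ler_wpM2l.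
- exact: ltW (hweight_gt0 h).
- by apply: fg; rewrite /= hk.
- by rewrite subr_ge0 hweight_le1.
- by apply: fg; rewrite /= hk.
Qed.

Lemma eq_hmean k f g :
  (forall h, size h = k -> f h = g h) -> hmean k f = hmean k g.
Proof.
by move=> fg; apply/eqP; rewrite eq_le !hmean_le// => h hk; rewrite fg.
Qed.

Lemma hmeanD k f g : hmean k (fun h => f h + g h) = hmean k f + hmean k g.
Proof.
elim: k f g => [//|k IH] f g /=; rewrite -IH; apply: eq_hmean => h _; ring.
Qed.

Lemma hmeanZ k c f : hmean k (fun h => c * f h) = c * hmean k f.
Proof.
elim: k f => [//|k IH] f /=; rewrite -IH; apply: eq_hmean => h _; ring.
Qed.

Lemma hmean_cst k c : hmean k (fun=> c) = c.
Proof.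
by elim: k => [//|k {2}<-] /=; apply: eq_hmean => h _; ring.
Qed.

(** * Second moments of the two martingales, and the decomposition of the twin count *)

Definition harm k : R := \sum_(i < k) i.+1%:R^-1.

Lemma harmS k : harm k.+1 = harm k + k.+1%:R^-1.
Proof. by rewrite /harm big_ord_recr. Qed.

Definition hrecip h := (hweight h)^-1.

(** With n = [size h + 2], dividing by 1 - 1/n means multiplying by n/(n - 1) = 1 + 1/(n - 1). *)
Lemma hrecip_true h :
  hrecip (true :: h) = hrecip h + hrecip h / (size h).+1%:R.
Proof.
have W0 := lt0r_neq0 (hweight_gt0 h); rewrite /hrecip/= addn2 -[in LHS]natr1.
have x0 : (0 : R) < (size h).+1%:R by rewrite ltr0n.
by field; rewrite W0 !lt0r_neq0//; lra.
Qed.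

Lemma hrecip_false h : hrecip (false :: h) = hrecip h.
Proof. by rewrite /hrecip/= mul1r. Qed.

(** The increment Y/(k + 1) occurs with probability W = 1/Y, so its conditional mean is 1/(k + 1)
    whatever the history. *)
Lemma hmean_hrecip k : hmean k hrecip = 1 + harm k.
Proof.
elim: k => [|k IH] /=; first by rewrite /harm big_ord0 /hrecip/= invr1 addr0.
rewrite harmS addrA -IH -[X in _ + X](hmean_cst k) -hmeanD.
apply: eq_hmean => h hk; rewrite hrecip_true hrecip_false hk /hrecip.
have W0 := lt0r_neq0 (hweight_gt0 h).
have K0 : k.+1%:R != 0 :> R by rewrite pnatr_eq0.
by move: k.+1%:R K0 => q K0; field; rewrite ?W0 ?K0//.
Qed.

Definition hdev h := hrecip h - 1 - harm (size h).

(** The conditional variance of the increment is (W Y^2 - 1)/(k + 1)^2 = (Y - 1)/(k + 1)^2, and Y -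
    1 has mean [harm k]. *)
Lemma hmean_hdev2S k : hmean k.+1 (fun h => hdev h ^+ 2) =
  hmean k (fun h => hdev h ^+ 2) + harm k / k.+1%:R ^+ 2.
Proof.
have -> : harm k = hmean k hrecip - 1 by rewrite hmean_hrecip; ring.
have -> : (hmean k hrecip - 1) / k.+1%:R ^+ 2
  = hmean k (fun h => k.+1%:R ^- 2 * (hrecip h + -1)).
  by rewrite hmeanZ hmeanD hmean_cst mulrC.
rewrite -hmeanD; apply: (@eq_hmean k) => h hk.
rewrite /hdev hrecip_true hrecip_false /= hk harmS.
have W0 := lt0r_neq0 (hweight_gt0 h).
have K0 : k.+1%:R != 0 :> R by rewrite pnatr_eq0.
by rewrite /hrecip; move: k.+1%:R K0 => q K0; field; rewrite ?W0 ?K0//.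
Qed.

Lemma hmean_hdev2_le k : hmean k (fun h => hdev h ^+ 2) <= 2.
Proof.
case: k => [|k].
  by rewrite /= /hdev /hrecip/= invr1 subrr /harm big_ord0 subr0 expr0n.
(* (1 + H_k)/k - (1 + H_(k+1))/(k+1) dominates the increment H_k/(k+1)^2. *)
suff: hmean k.+1 (fun h => hdev h ^+ 2) <= 2 - (1 + harm k.+1) / k.+1%:R.
  move/le_trans; apply; rewrite gerBl divr_ge0// addr_ge0//.
  by apply: sumr_ge0 => i _; rewrite invr_ge0.
elim: k => [|k IH].
  rewrite hmean_hdev2S /= /hdev /hrecip/= invr1 harmS /harm !big_ord0.
  lra.
rewrite hmean_hdev2S; apply: (le_trans (lerD IH (lexx _))).
rewrite [harm k.+2]harmS.
have := ler0n R k; set x := k%:R => x0.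
have H0 : 0 <= harm k.+1 by apply: sumr_ge0 => i _; rewrite invr_ge0.
set H := harm k.+1 in H0 *.
rewrite -[k.+2%:R]natr1 -[k.+1%:R]natr1 -/x.
rewrite -subr_ge0.
have -> : 2 - (1 + (H + (x + 1 + 1)^-1)) / (x + 1 + 1)
   - (2 - (1 + H) / (x + 1) + H / (x + 1 + 1) ^+ 2)
  = (1 + H) / ((x + 1) * (x + 1 + 1) ^+ 2).
  by field; rewrite !lt0r_neq0//; lra.
by rewrite divr_ge0// ?mulr_ge0 ?sqr_ge0//; lra.
Qed.

(* hbit 1 h is membership of n - 2, where n = size h + 2 is the next integer. *)
Definition hbit i h : R := (nth false h i)%:R.

Fixpoint hmart h : R :=
  if h is b :: h' then
    hmart h' + (b%:R - hweight h') * (hbit 1 h' + hweight h')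
  else 0.

(** A pair is counted when its larger element n is decided; the head of [h'] concerns n - 1, so n -
    2 sits at position 1. *)
Fixpoint htwin h : nat :=
  if h is b :: h' then (htwin h' + b && nth false h' 1)%N else 0%N.

Fixpoint hsquare h : R :=
  if h is b :: h' then hsquare h' + hweight h' ^+ 2 else 0.

Lemma hbit_ge0 i h : 0 <= hbit i h. Proof. exact: ler0n. Qed.

Lemma hbit_le1 i h : hbit i h <= 1. Proof. by rewrite /hbit; case: nth. Qed.

(** Given the history, the new bit has mean W, so the cross term vanishes and each step adds W(1 -
    W)(c + W)^2 <= 4, where c is the bit of n - 2. *)
Lemma hmean_hmart2 k : hmean k (fun h => hmart h ^+ 2) <= 4 * k%:R.
Proof.
elim: k => [|k IH]; first by rewrite /= expr0n mulr0.
have -> : 4 * k.+1%:R = 4 * k%:R + hmean k (fun=> 4) :> R.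
  by rewrite hmean_cst -natr1; ring.
apply: (le_trans _ (lerD IH (lexx _))); rewrite -hmeanD /=.
apply: hmean_le => h _.
have := hbit_ge0 1 h; have := hbit_le1 1 h.
have := hweight_gt0 h; have := hweight_le1 h.
set w := hweight h; set c := hbit 1 h; set m := hmart h => w1 w0 c1 c0.
have -> : w * (m + (true%:R - w) * (c + w)) ^+ 2
  + (1 - w) * (m + (false%:R - w) * (c + w)) ^+ 2
  = m ^+ 2 + (w * (1 - w)) * (c + w) ^+ 2 by rewrite /=; ring.
rewrite lerD2l -[leRHS]mul1r; apply: ler_pM.
- by rewrite mulr_ge0 ?subr_ge0// ltW.
- exact: sqr_ge0.
- by nra.
- nra.
Qed.

Lemma hmart_cons_dist b h : `|hmart (b :: h) - hmart h| <= 2.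
Proof.
rewrite /= addrC addKr normrM -[leRHS]mul1r.
have := hbit_ge0 1 h; have := hbit_le1 1 h.
have := hweight_gt0 h; have := hweight_le1 h => w1 w0 c1 c0.
apply: ler_pM => //.
  by rewrite ler_norml; case: b => /=; lra.
by rewrite ger0_norm; lra.
Qed.

Lemma htwin_decomp h : `|(htwin h)%:R - hmart h - hsquare h| <= 4.
Proof.
(* S changes by hbit 1 h * W_n - 1[n] * W_n, which up to the boundary term
   (hbit 0 h + hbit 1 h) * W_n is a multiple by at most 2 of a decrease of W. *)
set S := fun h => (htwin h)%:R - hmart h - hsquare h.
(* The decreases of W telescope to 1 - W, which gives an invariant suited to induction; both its
   bounds and the boundary term are at most 2 in absolute value. *)
suff : -2 * (1 - hweight h) <= S h + (hbit 0 h + hbit 1 h) * hweight h <= 0.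
  rewrite ler_norml -/(S h).
  have := hbit_ge0 1 h; have := hbit_le1 1 h.
  have := hbit_ge0 0 h; have := hbit_le1 0 h.
  have := hweight_gt0 h; have := hweight_le1 h.
  set w := hweight h; set c := hbit 1 h; set d := hbit 0 h.
  move=> w1 w0 d1 d0 c1 c0 /andP[a1 a2]; nra.
elim: h => [|b h /andP[IH1 IH2]].
  by rewrite /S /= /hbit /=; lra.
have step : S (b :: h) + (hbit 0 (b :: h) + hbit 1 (b :: h)) * hweight (b :: h)
   = S h + (hbit 0 h + hbit 1 h) * hweight h
     + (b%:R + hbit 0 h) * (hweight (b :: h) - hweight h).
  rewrite /S [htwin _]/= natrD /=.
  have -> : (b && nth false h 1)%:R = b%:R * hbit 1 h :> R.
    by rewrite /hbit; case: b; rewrite /= ?mul1r ?mul0r.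
  by rewrite {2 4}/hbit /= -/(hbit 0 h); ring.
rewrite step.
have := hweight_cons_le b h.
have := hbit_ge0 0 h; have := hbit_le1 0 h.
have /andP[b0 b1] : (0 <= b%:R :> R) && (b%:R <= 1 :> R).
  by case: b {step}; rewrite ?lexx ?ler01.
set w' := hweight (b :: h); set v := (b%:R + hbit 0 h) => d1 d0 ww.
have /andP[v0 v2] : (0 <= v) && (v <= 2) by rewrite /v; lra.
by apply/andP; split; nra.
Qed.

(** W is nonincreasing, so each of the [size h] squares is at least the latest one. *)
Lemma hsquare_ge h : (size h)%:R * hweight h ^+ 2 <= hsquare h.
Proof.
elim: h => [|b h IH]; first by rewrite mul0r.
rewrite [hsquare _]/= [size _]/= -natr1 mulrDl mul1r.
have ww := hweight_cons_le b h; have w0 := hweight_gt0 (b :: h).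
have w2 : hweight (b :: h) ^+ 2 <= hweight h ^+ 2.
  by rewrite ler_sqr// nnegrE ltW// hweight_gt0.
apply: lerD => //; apply: le_trans IH.
exact: ler_wpM2l.
Qed.

Lemma hweight_cat_le s h : hweight (s ++ h) <= hweight h.
Proof.
by elim: s => //= b s IH; apply: le_trans (hweight_cons_le b (s ++ h)) IH.
Qed.

(** The squares up to the cutoff [h2] are bounded by 1, the later ones by the square at the cutoff.
    The cutoff is chosen in the limit argument. *)
Lemma hsquare_cat_le h1 h2 :
  hsquare (h1 ++ h2) <= (size h2)%:R + (size h1)%:R * hweight h2 ^+ 2.
Proof.
elim: h1 => [|b h IH].
  rewrite mul0r addr0; elim: h2 => [|b h IH] //=.
  by rewrite -natr1 lerD// expr_le1 ?hweight_le1// ltW// hweight_gt0.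
rewrite /= -[(size h).+1%:R]natr1 mulrDl mul1r addrA lerD//.
by rewrite ler_sqr ?nnegrE ?hweight_cat_le//; exact: ltW (hweight_gt0 _).
Qed.

End HistoryChain.

(** * Histories of random sieves *)

Fixpoint hist k (alpha : sieve_space) : seq bool :=
  if k is k'.+1 then `[< sieve_set alpha (k' + 2)%N >] :: hist k' alpha
  else [::].

Lemma size_hist k alpha : size (hist k alpha) = k.
Proof. by elim: k => //= k ->. Qed.

(** Translates a history into the increasing index a_1, ..., a_k of an elementary set. *)
Fixpoint hlist (h : seq bool) : seq nat :=
  if h is b :: h' then
    if b then rcons (hlist h') (size h' + 2)%N else hlist h'
  else [::].

Lemma hlist_bound h a : a \in hlist h -> (2 <= a < size h + 2)%N.
Proof.
elim: h => [//|b h IH] /=.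
have {}IH : a \in hlist h -> (1 < a < (size h).+1 + 2)%N.
  by move=> /IH /andP[-> /=]; rewrite addSn; apply: ltnW.
case: b => //; rewrite mem_rcons inE => /orP[/eqP ->|//].
by rewrite addSn ltnS leqnn andbT addn2.
Qed.

Lemma hlist_elementary h : elementary_index (hlist h) (size h + 2).
Proof.
apply/and3P; split; first by rewrite addn2.
  rewrite (sorted_pairwise ltn_trans); elim: h => //= -[] h // IH.
  rewrite pairwise_rcons IH andbT; apply/allP => a /hlist_bound/andP[_].
  by [].
by apply/allP => a /hlist_bound.
Qed.

Lemma mem_hlist_hist k alpha m :
  (m \in hlist (hist k alpha)) = (2 <= m < k + 2)%N && `[< sieve_set alpha m >].
Proof.
elim: k => [|k IH] /=; first by case: m => [|[|[]]].
have [mk|mk] := eqVneq m (k + 2)%N.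
  rewrite {m}mk in IH *.
  rewrite addSn ltnS leqnn addn2 ltnS /= -addn2.
  case: asboolP => _; rewrite ?mem_rcons ?inE ?size_hist ?eqxx//.
  by rewrite IH ltnn andbF.
have -> : (m < k.+1 + 2)%N = (m < k + 2)%N by rewrite addSn ltnS leq_eqVlt (negbTE mk).
by case: ifP => _; rewrite ?mem_rcons ?inE ?size_hist ?(negbTE mk) IH.
Qed.

(** The head bit says whether the largest admissible integer is listed. Sizes must agree because a
    [false] bit leaves no trace in the list. *)
Lemma hlist_inj h1 h2 :
  size h1 = size h2 -> hlist h1 =i hlist h2 -> h1 = h2.
Proof.
elim: h1 h2 => [|b1 h1 IH] [|b2 h2]//= [eqs] eqm.
have last b h : (size h + 2)%N \in hlist (b :: h) = b.
  case: b; rewrite /= ?mem_rcons ?inE ?eqxx//.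
  by apply/negP => /hlist_bound; rewrite ltnn andbF.
have eqb : b1 = b2 by rewrite -(last b1 h1) -(last b2 h2) /= eqm eqs.
congr (_ :: _) => //; apply: IH => // m.
have := eqm m; rewrite -eqb -eqs; case: (b1) => //.
rewrite !mem_rcons !inE; case: eqVneq => //= -> _.
by apply/idP/idP => /hlist_bound; rewrite ?eqs ltnn andbF.
Qed.

Definition hist_event h : set sieve_space :=
  [set alpha | hist (size h) alpha = h].

(** Both sides prescribe [alpha] below [size h + 2]. This turns the recursion defining the measure
    into transition probabilities of the history chain. *)
Lemma elementary_set_hist h :
  elementary_set (hlist h) (size h + 2) = hist_event h.
Proof.
rewrite /elementary_set /hist_event; apply/seteqP; split => alpha /=.
  move=> e; apply: hlist_inj; first by rewrite size_hist.
  move=> m; rewrite mem_hlist_hist.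
  have /(congr1 (fun A : set nat => A m)) := e.
  rewrite /sieve_trunc /=; move=> /propeqP em.
  apply/andP/idP => [[mk /asboolP am]|]; first exact/em.
  by move=> /em[? ?]; split => //; apply/asboolP.
move=> e; apply/seteqP; split => m; rewrite /sieve_trunc /= -e mem_hlist_hist.
  by rewrite size_hist => -[am mk]; apply/andP; split => //; apply/asboolP.
by rewrite size_hist => /andP[mk /asboolP].
Qed.

Lemma measurable_hist_event h :
  measurable (hist_event h : set sieve_measurableType).
Proof.
apply: sub_sigma_algebra; exists (hlist h), (size h + 2)%N.
by split; [exact: hlist_elementary|rewrite elementary_set_hist].
Qed.

Fixpoint hseqs k : seq (seq bool) :=
  if k is k'.+1 then map (cons true) (hseqs k') ++ map (cons false) (hseqs k')
  else [:: [::]].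

Lemma hseqs_uniq k : uniq (hseqs k).
Proof.
elim: k => //= k IH; rewrite cat_uniq !map_inj_uniq; try by move=> ? ? [].
rewrite IH andbT /=; apply/hasPn => h /mapP[h' _ ->].
by apply/negP => /mapP[].
Qed.

Lemma hist_in_hseqs k alpha : hist k alpha \in hseqs k.
Proof.
elim: k => //= k IH; rewrite mem_cat; apply/orP.
by case: asboolP => _; [left|right]; rewrite map_f.
Qed.

Lemma size_hseqs k h : h \in hseqs k -> size h = k.
Proof.
elim: k h => [|k IH] h /=; first by rewrite inE => /eqP ->.
by rewrite mem_cat => /orP[] /mapP[h' /IH <- ->].
Qed.

(** * Moments under the Hawkins measure *)

Section Hawkins.
Variables (R : realType) (mu : probability sieve_measurableType R).
Hypothesis mu_hawkins : is_hawkins_measure mu.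

Lemma sieve_weight_hlist h : sieve_weight R (hlist h) = hweight R h.
Proof.
rewrite /sieve_weight; elim: h => [|b h IH] /=; first by rewrite big_nil.
by case: b; rewrite ?mul1r// -cats1 big_cat/= big_seq1 IH mulrC.
Qed.

Lemma hawkins_hist_event0 : mu (hist_event [::]) = 1%E.
Proof. by have [+ _ _] := mu_hawkins; rewrite -elementary_set_hist. Qed.

Lemma hawkins_hist_event b h : mu (hist_event (b :: h)) =
  ((if b then hweight R h else 1 - hweight R h)%:E * mu (hist_event h))%E.
Proof.
have [_ muT muF] := mu_hawkins.
rewrite -!elementary_set_hist -sieve_weight_hlist [size _]/= addSn.
by case: b; [apply: muT|apply: muF]; exact: hlist_elementary.
Qed.

(** A function of the history is a simple function on the events [hist_event h], which gives both
    its measurability and its integral. *)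
Lemma hist_expand (f : seq bool -> R) k alpha :
  f (hist k alpha) = \sum_(h <- hseqs k) f h * \1_(hist_event h) alpha.
Proof.
have hk := hist_in_hseqs k alpha.
rewrite (bigD1_seq _ hk (hseqs_uniq k))/= big_seq_cond big1 => [|h].
  rewrite addr0 indicE mem_set ?mulr1// /hist_event/=.
  by rewrite (size_hseqs hk).
move=> /andP[/size_hseqs <- nh]; rewrite indicE memNset ?mulr0//= => e.
by move: nh; rewrite e eqxx.
Qed.

Lemma measurable_hist (f : seq bool -> R) k :
  measurable_fun setT (fun alpha : sieve_measurableType => f (hist k alpha)).
Proof.
under eq_fun do rewrite hist_expand.
apply: measurable_sum => h; apply: measurable_funM; first exact: measurable_cst.
by apply: measurable_indic; exact: measurable_hist_event.
Qed.

(** By induction on k: the two extensions of [h] split the mass of [hist_event h] in the proportions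
    W and 1 - W that [hmean] uses. *)
Lemma integral_hist (f : seq bool -> R) k : (forall h, 0 <= f h) ->
  (\int[mu]_alpha (f (hist k alpha))%:E = (hmean k f)%:E)%E.
Proof.
move=> f0.
transitivity (\sum_(h <- hseqs k) (f h)%:E * mu (hist_event h))%E.
  under eq_integral do rewrite hist_expand -sumEFin.
  rewrite ge0_integral_sum//.
  - apply: eq_bigr => h _.
    under eq_integral do rewrite EFinM.
    rewrite ge0_integralZl_EFin//.
    + by rewrite integral_indic ?setIT//; exact: measurable_hist_event.
    + by apply/measurable_EFinP/measurable_indic; exact: measurable_hist_event.
  - move=> h; apply/measurable_EFinP/measurable_funM; first exact: measurable_cst.
    by apply: measurable_indic; exact: measurable_hist_event.
  - by move=> h alpha _; rewrite lee_fin mulr_ge0.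
elim: k f f0 => [|k IH] f f0; first by rewrite /= big_seq1 hawkins_hist_event0 mule1.
rewrite [hmean _ _]/= -IH => [|h]; last first.
  have := hweight_gt0 R h; have := hweight_le1 R h => w1 w0.
  by rewrite addr_ge0// mulr_ge0 ?subr_ge0// ltW.
rewrite /= big_cat /= !big_map -big_split /=; apply: eq_bigr => h _ /=.
rewrite !hawkins_hist_event !muleA -!EFinM -ge0_muleDl ?lee_fin; last 2 first.
- by rewrite mulr_ge0 ?f0// ltW ?hweight_gt0.
- by rewrite mulr_ge0 ?f0// subr_ge0 hweight_le1.
by rewrite -EFinD mulrC; congr (_%:E * _)%E; ring.
Qed.

End Hawkins.

(** * Almost sure bounds along the sampling times *)

(** The series of the [g j] has finite integral, hence a finite sum almost everywhere, and that sum
    bounds every nonnegative term. *)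
Lemma ae_bounded_of_summable d (T : measurableType d) (R : realType)
    (mu : {measure set T -> \bar R}) (g : nat -> T -> R) (a : nat -> R) (C : R) :
  (forall j, measurable_fun setT (g j)) -> (forall j x, 0 <= g j x) ->
  (forall j, \int[mu]_x (g j x)%:E <= (a j)%:E)%E ->
  (forall n, \sum_(j < n) a j <= C) ->
  {ae mu, forall x, exists B, forall j, g j x <= B}.
Proof.
move=> mg g0 ga aC.
pose F x := (\sum_(j <oo) (g j x)%:E)%E.
have F0 x : (0 <= F x)%E by apply: nneseries_ge0 => j _ _; rewrite lee_fin.
have mF : measurable_fun setT F.
  by apply: ge0_emeasurable_sum => *; rewrite ?lee_fin//; exact/measurable_EFinP.
have iF : mu.-integrable setT F.
  apply/integrableP; split => //.
  under eq_integral do rewrite gee0_abs//.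
  rewrite integral_nneseries//; last 2 first.
  - by move=> j; exact/measurable_EFinP.
  - by move=> j x _; rewrite lee_fin.
  apply: (@le_lt_trans _ _ C%:E); last exact: ltry.
  apply: lime_le.
    by apply: is_cvg_nneseries => j _ _; apply: integral_ge0 => x _; rewrite lee_fin.
  apply: nearW => n; apply: (@le_trans _ _ (\sum_(j < n) a j)%:E).
    by rewrite -sumEFin big_mkord; apply: lee_sum.
  by rewrite lee_fin.
apply: filterS (integrable_ae measurableT iF) => x /(_ I) Fx.
exists (fine (F x)) => j; rewrite -lee_fin fineK//.
rewrite /F (@nneseriesD1 _ _ j)//; last by move=> *; rewrite lee_fin.
by rewrite leeDl// nneseries_ge0// => *; rewrite lee_fin.
Qed.

Lemma sum_inv_sqr_le (R : realFieldType) n : \sum_(j < n) (j.+1%:R ^+ 2)^-1 <= 2 :> R.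
Proof.
(* The sharper bound telescopes, as 1/(n + 1)^2 <= 1/n - 1/(n + 1) for n >= 1. Since the inverse of
   0 is 0, the step from 0 to 1 is checked separately. *)
suff: \sum_(j < n) (j.+1%:R ^+ 2)^-1 <= 2 - n%:R^-1 :> R.
  by move/le_trans; apply; rewrite gerBl invr_ge0.
elim: n => [|[|n] IH]; first by rewrite big_ord0 invr0 subr0.
  by rewrite big_ord1 expr1n invr1; lra.
rewrite big_ord_recr; apply: (le_trans (lerD IH (lexx _))) => /=.
rewrite -[n.+2%:R]natr1; have : (0 : R) < n.+1%:R by rewrite ltr0n.
move: n.+1%:R => x x0; rewrite -subr_ge0.
have -> : 2 - (x + 1)^-1 - (2 - x^-1 + ((x + 1) ^+ 2)^-1) = (x * (x + 1) ^+ 2)^-1.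
  by field; rewrite !lt0r_neq0//; lra.
by rewrite invr_ge0 mulr_ge0 ?sqr_ge0// ltW.
Qed.

(** At n = 2^(j^2), ln n = j^2 ln 2, so j + 1 is of the order of sqrt (ln n); second moments at most
    2 become summable after division by (j + 1)^2. *)
Lemma ae_dev_bound (R : realType) (mu : probability sieve_measurableType R) :
  is_hawkins_measure mu ->
  {ae mu, forall alpha : sieve_space, exists B, forall j,
    (hdev R (hist (2 ^ (j ^ 2)) alpha)) ^+ 2 / j.+1%:R ^+ 2 <= B}.
Proof.
move=> H.
apply: (@ae_bounded_of_summable _ _ _ _ _ (fun j => 2 * (j.+1%:R ^+ 2)^-1) 4).
- by move=> j; apply: (measurable_hist (fun h => hdev R h ^+ 2 / j.+1%:R ^+ 2)).
- by move=> j x; rewrite divr_ge0 ?sqr_ge0.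
- move=> j; rewrite (integral_hist H (f := fun h => hdev R h ^+ 2 / j.+1%:R ^+ 2)).
    rewrite lee_fin; under eq_hmean do rewrite mulrC.
    by rewrite hmeanZ mulrC ler_wpM2r ?invr_ge0 ?sqr_ge0 ?hmean_hdev2_le.
  by move=> h; rewrite divr_ge0 ?sqr_ge0.
- move=> n; rewrite -mulr_sumr; have := sum_inv_sqr_le R n; lra.
Qed.

(** At n = j^4 the second moment is at most 4 j^4, so division by (j + 1)^6 leaves a summable bound;
    (j + 1)^3 is of the order of n^(3/4). *)
Lemma ae_mart_bound (R : realType) (mu : probability sieve_measurableType R) :
  is_hawkins_measure mu ->
  {ae mu, forall alpha : sieve_space, exists B, forall j,
    (hmart R (hist (j ^ 4) alpha)) ^+ 2 / j.+1%:R ^+ 6 <= B}.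
Proof.
move=> H.
apply: (@ae_bounded_of_summable _ _ _ _ _ (fun j => 4 * (j.+1%:R ^+ 2)^-1) 8).
- by move=> j; apply: (measurable_hist (fun h => hmart R h ^+ 2 / j.+1%:R ^+ 6)).
- by move=> j x; rewrite divr_ge0 ?sqr_ge0// exprn_ge0.
- move=> j; rewrite (integral_hist H (f := fun h => hmart R h ^+ 2 / j.+1%:R ^+ 6)).
    rewrite lee_fin; under eq_hmean do rewrite mulrC.
    rewrite hmeanZ; apply: (@le_trans _ _ ((j.+1%:R ^+ 6)^-1 * (4 * j.+1%:R ^+ 4))).
      rewrite ler_wpM2l ?invr_ge0 ?exprn_ge0//.
      apply: (le_trans (hmean_hmart2 _ _)); rewrite ler_wpM2l//.
      by rewrite -natrX ler_nat leq_exp2r.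
    have : (0 : R) < j.+1%:R by rewrite ltr0n.
    move: j.+1%:R => x /lt0r_neq0 x0.
    by rewrite le_eqVlt; apply/orP; left; apply/eqP; field.
  by move=> h; rewrite divr_ge0 ?sqr_ge0// exprn_ge0.
- move=> n; rewrite -mulr_sumr; have := sum_inv_sqr_le R n; lra.
Qed.

(** * Interpolation between the sampling times *)

Section Interpolation.
Variable R : realType.

Lemma ln_natS_le n : ln n.+2%:R <= ln n.+1%:R + n.+1%:R^-1 :> R.
Proof.
have n0 : (0 : R) < n.+1%:R by rewrite ltr0n.
have -> : n.+2%:R = n.+1%:R * (1 + n.+1%:R^-1) :> R.
  by rewrite mulrDr mulr1 divff ?lt0r_neq0// natr1.
have i0 : (0 : R) < n.+1%:R^-1 by rewrite invr_gt0.
move: (_^-1) i0 => i i0; rewrite lnM ?posrE//; last by lra.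
by rewrite lerD2l le_ln1Dx//; lra.
Qed.

Lemma ln_natS_ge n : ln n.+1%:R + n.+2%:R^-1 <= ln n.+2%:R :> R.
Proof.
have n0 : (0 : R) < n.+1%:R by rewrite ltr0n.
have n2 : (1 : R) < n.+2%:R by rewrite ltr1n.
have i1 : n.+2%:R^-1 < 1 :> R by rewrite invf_lt1//; lra.
have -> : n.+1%:R = n.+2%:R * (1 + - n.+2%:R^-1) :> R.
  by rewrite mulrBr mulr1 divff ?lt0r_neq0// -natr1; ring.
move: (_^-1) i1 => i i1; rewrite lnM ?posrE; try lra.
by have := @le_ln1Dx R (- i); lra.
Qed.

Lemma ln_le_harm n : ln n.+1%:R <= harm R n.
Proof.
elim: n => [|n IH]; first by rewrite ln1 /harm big_ord0.
by rewrite harmS; apply: (le_trans (ln_natS_le n)); rewrite lerD2r.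
Qed.

Lemma harm_le_ln n : harm R n.+1 <= 1 + ln n.+1%:R.
Proof.
elim: n => [|n IH]; first by rewrite ln1 /harm big_ord1 invr1 addr0.
rewrite harmS; apply: (le_trans (lerD IH (lexx _))).
by rewrite -addrA lerD2l ln_natS_ge.
Qed.

Lemma ln2_bounds : 0 < ln 2 :> R /\ ln 2 <= 1 :> R.
Proof.
split; first by rewrite ln_gt0// ltr1n.
by have := @le_ln1Dx R 1; rewrite -[1 + 1]/(2%:R); apply; lra.
Qed.

Lemma ler_ln_nat m n : (0 < m)%N -> (m <= n)%N -> ln m%:R <= ln n%:R :> R.
Proof.
move=> m0 mn; rewrite ler_ln ?posrE ?ler_nat ?ltr0n//.
exact: leq_trans mn.
Qed.

Lemma ln_nat_ge0 n : 0 <= ln n%:R :> R.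
Proof.
by case: n => [|n]; [rewrite ln0|rewrite ln_ge0// ler1n].
Qed.

Lemma hist_add i j alpha : exists2 s, hist (i + j) alpha = s ++ hist j alpha & size s = i.
Proof.
elim: i => [|i [s e sz]]; first by exists [::].
by rewrite addSn /= e; exists (`[< sieve_set alpha (i + j + 2)%N >] :: s); rewrite //= sz.
Qed.

Lemma hrecip_hist_le alpha m n : (m <= n)%N ->
  hrecip R (hist m alpha) <= hrecip R (hist n alpha).
Proof.
move=> mn; have [s + _] := hist_add (n - m) m alpha; rewrite subnK// => ->.
by rewrite lef_pV2 ?posrE ?hweight_gt0 ?hweight_cat_le.
Qed.

Lemma nat_bracket (f : nat -> nat) n : (f 0 <= n)%N -> (forall j, j <= f j)%N ->
  exists j, (f j <= n < f j.+1)%N.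
Proof.
move=> f0 fj.
have ex : exists j, (f j <= n)%N by exists 0%N.
have ub j : (f j <= n)%N -> (j <= n)%N by apply: leq_trans.
have [j fn jmax] := ex_maxnP ex ub; exists j; rewrite fn /= ltnNge.
by apply/negP => /jmax; rewrite ltnn.
Qed.

(** [B + 1] replaces the square root of [B]: B <= (B + 1)^2 for B >= 0. *)
Lemma sqr_le_normr (B x y : R) : 0 < y -> x ^+ 2 / y ^+ 2 <= B ->
  `|x| <= (B + 1) * y.
Proof.
move=> y0 xB; have B0 : 0 <= B by apply: le_trans xB; rewrite divr_ge0 ?sqr_ge0.
have b0 : 0 <= (B + 1) * y by rewrite mulr_ge0 ?ltW//; lra.
rewrite -ler_sqr ?nnegrE//.
rewrite real_normK ?num_real// exprMn.
rewrite -ler_pdivrMr ?exprn_gt0//.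
by apply: (le_trans xB); nra.
Qed.

(** Y and ln are both monotone, and ln grows by only (2j + 1) ln 2 between consecutive sampling
    times, the same order j as the deviation allowed there. *)
Lemma recip_sub_ln_bound alpha :
  (exists B, forall j,
    (hdev R (hist (2 ^ (j ^ 2)) alpha)) ^+ 2 / j.+1%:R ^+ 2 <= B) ->
  exists C, forall n, (0 < n)%N ->
    (hrecip R (hist n alpha) - ln n%:R) ^+ 2 <= C * (1 + ln n%:R).
Proof.
move=> [B HB]; set b := B + 1.
have B0 : 0 <= B by apply: le_trans (HB 0%N); rewrite divr_ge0 ?sqr_ge0.
have [l0 l1] := ln2_bounds; set l := ln 2 in l0 l1.
have devb j : `|hdev R (hist (2 ^ (j ^ 2)) alpha)| <= b * (j%:R + 1).
  by rewrite natr1; apply: sqr_le_normr (HB j); rewrite ltr0n.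
have lnp j : ln (2 ^ (j ^ 2))%:R = j%:R ^+ 2 * l :> R.
  by rewrite natrX lnXn// -natrX mulr_natl.
have Yb j : 1 + j%:R ^+ 2 * l - b * (j%:R + 1)
    <= hrecip R (hist (2 ^ (j ^ 2)) alpha) <= 2 + j%:R ^+ 2 * l + b * (j%:R + 1).
  have := devb j; rewrite ler_norml /hdev size_hist.
  (* With N = 2^(j^2), the two comparisons at N - 1 read ln N <= H_(N-1) and H_N <= 1 + ln N. *)
  have /prednK : (0 < 2 ^ (j ^ 2))%N by rewrite expn_gt0.
  have := ln_le_harm (2 ^ (j ^ 2)).-1; have := harm_le_ln (2 ^ (j ^ 2)).-1.
  move=> + + e; rewrite e lnp.
  have : harm R (2 ^ (j ^ 2)).-1 <= harm R (2 ^ (j ^ 2)) by rewrite -[in leRHS]e harmS lerDl.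
  lra.
(* The deviation is at most (b + 2)(j + 2), and (j + 2)^2 <= 2 j^2 + 8 <= 2 (ln n)/l + 8. *)
exists ((b + 2) ^+ 2 * (2 / l + 8)) => n n0.
have [j /andP[jn nj]] : exists j, (2 ^ (j ^ 2) <= n < 2 ^ (j.+1 ^ 2))%N.
  apply: (@nat_bracket (fun j => 2 ^ (j ^ 2))%N) => // j.
  apply: (leq_trans _ (ltnW (ltn_expl (j ^ 2) (ltnSn 1)))).
  by rewrite -mulnn; case: j => // j; rewrite leq_pmulr.
have jL : j%:R ^+ 2 * l <= ln n%:R :> R.
  by rewrite -lnp ler_ln_nat// expn_gt0.
have Lj : ln n%:R <= (j%:R + 1) ^+ 2 * l :> R.
  by rewrite natr1 -lnp ler_ln_nat// ltnW.
have Y0Y := hrecip_hist_le alpha jn; have YY1 := hrecip_hist_le alpha (ltnW nj).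
have /andP[Y0b _] := Yb j; have /andP[_ Y1b] := Yb j.+1.
rewrite -[j.+1%:R]natr1 in Y1b.
have x0 : (0 : R) <= j%:R by [].
have L0 := ln_nat_ge0 n.
move: (j%:R : R) x0 jL Lj Y0b Y1b => x x0 jL Lj Y0b Y1b.
move: (ln n%:R) (hrecip R (hist n alpha)) L0 jL Lj Y0Y YY1 => L Y L0 jL Lj Y0Y YY1.
move: (hrecip R _) (hrecip R _) Y0b Y1b Y0Y YY1 => Y0 Y1 Y0b Y1b Y0Y YY1.
have b0 : 0 <= b by rewrite /b; lra.
have : `|Y - L| <= (b + 2) * (x + 2).
  rewrite ler_norml; apply/andP; split; nra.
rewrite -ler_sqr ?nnegrE; try (by rewrite ?mulr_ge0//; lra).
rewrite real_normK ?num_real// exprMn => /le_trans; apply.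
rewrite -[leRHS]mulrA ler_wpM2l ?sqr_ge0//.
have xL : x ^+ 2 <= L / l by rewrite ler_pdivlMr.
have l'0 : 0 < l^-1 by rewrite invr_gt0.
apply: (@le_trans _ _ (2 * (L / l) + 8)); last by move: l^-1 l'0 => i i0; nra.
by have := sqr_ge0 (x - 2); move: (L / l) xL => q; nra.
Qed.

Lemma hmart_hist_add i j alpha :
  `|hmart R (hist (i + j) alpha) - hmart R (hist j alpha)| <= 2 * i%:R.
Proof.
elim: i => [|i IH]; first by rewrite subrr normr0 mulr0.
have := hmart_cons_dist R `[< sieve_set alpha (i + j + 2)%N >] (hist (i + j) alpha).
rewrite -/(hist (i + j).+1 alpha) -[i.+1%:R]natr1 addSn => D.
rewrite -(subrK (hmart R (hist (i + j) alpha)) (hmart R (hist _.+1 _))) -addrA.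
by apply: (le_trans (ler_normD _ _)); move: D IH; lra.
Qed.

(** Fourth powers express O(n^(3/4)) with natural exponents. From j^4 to (j + 1)^4 the increments,
    at most 2 each, add up to O(j^3), the order of the bound at j^4. *)
Lemma mart_bound alpha :
  (exists B, forall j,
    (hmart R (hist (j ^ 4) alpha)) ^+ 2 / j.+1%:R ^+ 6 <= B) ->
  exists C, forall n, `|hmart R (hist n alpha)| ^+ 4 <= C * n%:R ^+ 3.
Proof.
move=> [B HB]; set b := B + 1.
have B0 : 0 <= B by apply: le_trans (HB 0%N); rewrite divr_ge0 ?sqr_ge0 ?exprn_ge0.
have Nb j : `|hmart R (hist (j ^ 4) alpha)| <= b * (j%:R + 1) ^+ 3.
  rewrite natr1; apply: sqr_le_normr; first by rewrite exprn_gt0// ltr0n.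
  by rewrite -exprM.
(* For n >= 1 the bracket has j >= 1, so j + 1 <= 2 j and the bound (b + 8)(2 j)^3 follows; its
   fourth power is (b + 8)^4 2^12 j^12, with j^4 <= n. *)
exists ((b + 8) ^+ 4 * 2 ^+ 12) => -[|n].
  by rewrite /= normr0 !expr0n mulr0.
have [j /andP[jn nj]] : exists j, (j ^ 4 <= n.+1 < j.+1 ^ 4)%N.
  apply: (@nat_bracket (fun j => j ^ 4)%N) => // j.
  by case: j => // j; rewrite expnS leq_pmulr// expn_gt0.
have j0 : (0 < j)%N by case: j nj {jn}.
have jnR : j%:R ^+ 4 <= n.+1%:R :> R by rewrite -natrX ler_nat.
have njR : n.+1%:R <= (j%:R + 1) ^+ 4 :> R by rewrite natr1 -natrX ler_nat ltnW.
have j0R : (1 : R) <= j%:R by rewrite ler1n.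
have := hmart_hist_add (n.+1 - j ^ 4) (j ^ 4) alpha.
rewrite subnK// natrB// natrX => D; have := Nb j => N0.
have b0 : 0 <= b by rewrite /b; lra.
have : `|hmart R (hist n.+1 alpha)| <= (b + 8) * (2 * j%:R) ^+ 3.
  rewrite -(subrK (hmart R (hist (j ^ 4) alpha)) (hmart R (hist n.+1 alpha))).
  apply: (le_trans (ler_normD _ _)); apply: (le_trans (lerD D N0)).
  move: (n.+1%:R : R) (j%:R : R) jnR njR j0R => m x jm mj x1.
  apply: (@le_trans _ _ ((b + 8) * (x + 1) ^+ 3)).
    have : 0 <= x ^+ 3 by rewrite exprn_ge0//; lra.
    have : 0 <= x ^+ 2 by rewrite exprn_ge0//; lra.
    nra.
  rewrite ler_wpM2l ?lerXn2r ?nnegrE//; lra.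
move=> /(lerXn2r 4); rewrite !nnegrE normr_ge0 => /(_ isT).
rewrite mulr_ge0 ?exprn_ge0 ?mulr_ge0//; [|lra] => /(_ isT).
move/le_trans; apply.
rewrite exprMn -[leRHS]mulrA ler_wpM2l ?exprn_ge0//; first lra.
rewrite -exprM exprMn ler_wpM2l ?exprn_ge0// [(3 * 4)%N]mulnC exprM.
by rewrite lerXn2r ?nnegrE ?exprn_ge0.
Qed.

End Interpolation.

(** * Limits *)

Lemma cvg0_exprn (R : realType) (T : Type) (F : set_system T) {FF : Filter F}
    (f : T -> R) n : (0 < n)%N ->
  f x ^+ n @[x --> F] --> (0 : R) -> f x @[x --> F] --> (0 : R).
Proof.
move=> n0 /cvgr0Pnorm_lt fn; apply/cvgr0Pnorm_lt => e e0.
apply: filterS (fn _ (exprn_gt0 n e0)) => x.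
by rewrite normrX ltr_pXn2r// nnegrE ltW.
Qed.

Section Limits.
Variable R : realType.

Lemma cvg_ln_pinfty : ln x @[x --> +oo] --> (+oo : set_system R).
Proof.
apply/cvgryPge => A; near=> x.
rewrite -(expRK A) ler_ln ?posrE ?expR_gt0//; near: x; exact: nbhs_pinfty_ge.
Unshelve. all: by end_near. Qed.


Lemma cvgV_pinfty (T : Type) (F : set_system T) {FF : Filter F} (f : T -> R) :
  f x @[x --> F] --> +oo -> (f x)^-1 @[x --> F] --> (0 : R).
Proof.
move=> fy; apply: (gtr0_cvgV0 _).2 => //.
by move/cvgryPgt : fy => /(_ 0).
Qed.

(** The bound e^y >= y^(p+1)/(p+1)! at y = ln x has one power of ln x to spare. *)
Lemma cvg_ln_expr_div p : ln x ^+ p / x @[x --> +oo] --> (0 : R).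
Proof.
apply: (@squeeze_cvgr _ _ _ _ (fun=> 0) (fun x => p.+1`!%:R * (ln x)^-1)).
- near=> x.
  have x1 : 1 < x by near: x; exact: nbhs_pinfty_gt.
  have y0 := ln_gt0 x1; have x0 : 0 < x by apply: lt_trans x1.
  apply/andP; split; first by rewrite divr_ge0 ?exprn_ge0// ltW.
  rewrite ler_pdivrMr// mulrAC ler_pdivlMr//.
  rewrite -exprSr -ler_pdivrMl ?ltr0n ?fact_gt0// mulrC.
  have := expR_ge1Dxn p (ltW y0); rewrite lnK ?posrE//.
  by apply: le_trans; rewrite lerDr.
- exact: cvg_cst.
- rewrite -[X in _ --> X](mulr0 p.+1`!%:R); apply: cvgM; first exact: cvg_cst.
  by apply: cvgV_pinfty; exact: cvg_ln_pinfty.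
Unshelve. all: by end_near. Qed.

Lemma cvg_ln_nat : ln n%:R @[n --> \oo] --> (+oo : set_system R).
Proof. exact: (cvg_comp _ _ cvgr_idn cvg_ln_pinfty). Qed.

Lemma cvg_ln_expr_div_nat p : ln n%:R ^+ p / n%:R @[n --> \oo] --> (0 : R).
Proof. exact: (cvg_comp _ _ cvgr_idn (cvg_ln_expr_div p)). Qed.

Lemma near_ln_nat_ge (A : R) : \forall n \near \oo, A <= ln n%:R.
Proof. by move/cvgryPge : cvg_ln_nat => /(_ A). Qed.

Lemma cvg_div_ln_of_sqr_dev (Y : nat -> R) :
  (exists C, forall n, (0 < n)%N -> (Y n - ln n%:R) ^+ 2 <= C * (1 + ln n%:R)) ->
  Y n / ln n%:R @[n --> \oo] --> (1 : R).
Proof.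
move=> [C YC]; apply/subr_cvg0; apply: (@cvg0_exprn _ _ _ _ _ 2) => //.
have VL := cvgV_pinfty cvg_ln_nat.
apply: (@squeeze_cvgr _ _ _ _ (fun=> 0)
  (fun n => C * ((ln n%:R)^-1 * (ln n%:R)^-1 + (ln n%:R)^-1))).
- near=> n; rewrite sqr_ge0/=.
  have L1 : 1 <= ln n%:R :> R by near: n; exact: near_ln_nat_ge.
  have := YC n; have n0 : (0 < n)%N by near: n; exact: nbhs_infty_gt.
  move=> /(_ n0); move: (ln n%:R) L1 => L L1 YL.
  have L0 : 0 < L by apply: lt_le_trans L1.
  have -> : Y n / L - 1 = (Y n - L) / L by rewrite mulrBl divff ?lt0r_neq0.
  rewrite expr_div_n ler_pdivrMr ?exprn_gt0//; apply: (le_trans YL).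
  by rewrite le_eqVlt; apply/orP; left; apply/eqP; field; exact: lt0r_neq0.
- exact: cvg_cst.
- rewrite [X in _ --> X](_ : _ = C * (0 * 0 + 0)); last by rewrite mulr0 addr0 mulr0.
  apply: cvgM; first exact: cvg_cst.
  by apply: cvgD; [apply: cvgM; exact: VL|exact: VL].
Unshelve. all: by end_near. Qed.

(** The cutoff m = floor (n/(ln n)^3) is small enough that the term m contributes at most 1/ln n
    after scaling, and large enough that ln m ~ ln n, hence Y m ~ ln n. *)
Lemma cvg_sum_inv_sqr (Y Q : nat -> R) :
  (forall n, 0 < Y n) -> {homo Y : m n / (m <= n)%N >-> m <= n} ->
  Y n / ln n%:R @[n --> \oo] --> (1 : R) ->
  (forall n, n%:R / Y n ^+ 2 <= Q n) ->
  (forall m n, (m <= n)%N -> Q n <= m%:R + n%:R / Y m ^+ 2) ->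
  Q n * (ln n%:R ^+ 2 / n%:R) @[n --> \oo] --> (1 : R).
Proof.
move=> Y0 Yle Ycvg Qge Qle.
pose r n : R := n%:R / ln n%:R ^+ 3; pose m n := Num.truncn (r n).
have ry : r n @[n --> \oo] --> +oo.
  have := @cvg_ln_expr_div_nat 3.
  have -> : (fun n => ln n%:R ^+ 3 / n%:R) = (fun n => (r n)^-1).
    by apply/funext => n; rewrite invf_div.
  apply: (gtr0_cvgV0 _).1; near=> n; rewrite divr_gt0//.
    by rewrite ltr0n; near: n; exact: nbhs_infty_gt.
  by rewrite exprn_gt0//; apply: (@lt_le_trans _ _ 1) => //; near: n; exact: near_ln_nat_ge.
have mtr : \forall n \near \oo, (m n)%:R <= r n < (m n).+1%:R.
  move/cvgryPge : ry => /(_ 0); apply: filterS => n; exact: truncn_itv.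
have mooR : ((m n)%:R : R) @[n --> \oo] --> +oo.
  apply/cvgryPge => A; near=> n.
  have : A + 1 <= r n by near: n; move/cvgryPge : ry; apply.
  have : (m n)%:R <= r n < (m n).+1%:R by near: n.
  by rewrite -[(m n).+1%:R]natr1; lra.
have moo : m n @[n --> \oo] --> \oo by apply/(@cvgrnyP R).
have YmL : Y (m n) / ln (m n)%:R @[n --> \oo] --> (1 : R) by exact: (cvg_comp _ _ moo Ycvg).
have VL := cvgV_pinfty cvg_ln_nat.
have lnln : ln (ln n%:R) / ln n%:R @[n --> \oo] --> (0 : R).
  have := cvg_comp _ _ cvg_ln_nat (cvg_ln_expr_div 1).
  by under eq_fun do rewrite /= expr1.
(* From n/(ln n)^3 < m + 1 <= 2 m, ln m >= ln n - 3 ln (ln n) - ln 2; the upper bound is m <= n. *)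
have lnm : ln (m n)%:R / ln n%:R @[n --> \oo] --> (1 : R).
  apply: (@squeeze_cvgr _ _ _ _
    (fun n => 1 - 3 * (ln (ln n%:R) / ln n%:R) - ln 2 * (ln n%:R)^-1) (fun=> 1)).
  - near=> n.
    have L1 : 1 <= ln n%:R :> R by near: n; exact: near_ln_nat_ge.
    have L0 : 0 < ln n%:R :> R by apply: lt_le_trans L1.
    have n0 : 0 < n%:R :> R by rewrite ltr0n; near: n; exact: nbhs_infty_gt.
    have m1 : (1 : R) <= (m n)%:R.
      by near: n; move/cvgryPge : mooR; apply.
    have /andP[mr rm] : (m n)%:R <= r n < (m n).+1%:R by near: n.
    rewrite ler_pdivlMr// ler_pdivrMr// mul1r; apply/andP; split.
      have : ln (r n) <= ln (2 * (m n)%:R).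
        have r0 : 0 < r n by rewrite divr_gt0 ?exprn_gt0.
        by rewrite ler_ln ?posrE//; move: rm; rewrite -[(m n).+1%:R]natr1; lra.
      rewrite lnM ?posrE//; last by lra.
      rewrite /r ln_div ?posrE ?exprn_gt0// lnXn// -mulr_natl.
      rewrite mulrBl mulrBl mul1r -!mulrA mulVf ?lt0r_neq0// !mulr1; lra.
    rewrite ler_ln ?posrE//; last by lra.
    apply: (le_trans mr); rewrite ler_pdivrMr ?exprn_gt0//.
    by rewrite ler_peMr ?exprn_ege1// ltW.
  - rewrite [X in _ --> X](_ : _ = 1 - 3 * 0 - ln 2 * 0); last by rewrite !mulr0 !subr0.
    apply: cvgB; last by apply: cvgM; [exact: cvg_cst|exact: VL].
    by apply: cvgB; [exact: cvg_cst|apply: cvgM; [exact: cvg_cst|exact: lnln]].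
  - exact: cvg_cst.
have LYm : ((Y (m n) / ln (m n)%:R) * (ln (m n)%:R / ln n%:R))^-1 ^+ 2
    @[n --> \oo] --> (1 : R).
  rewrite [X in _ --> X](_ : _ = (1 * 1)^-1 * (1 * 1)^-1); last by rewrite !mulr1 invr1 mulr1.
  by apply: cvgM; (apply: cvgV; [by rewrite mulr1 oner_eq0|apply: cvgM; [exact: YmL|exact: lnm]]).
apply: (@squeeze_cvgr _ _ _ _ (fun n => (Y n / ln n%:R)^-1 ^+ 2) (fun n =>
   (ln n%:R)^-1 + ((Y (m n) / ln (m n)%:R) * (ln (m n)%:R / ln n%:R))^-1 ^+ 2)).
- near=> n.
  have L1 : 1 <= ln n%:R :> R by near: n; exact: near_ln_nat_ge.
  have L0 : 0 < ln n%:R :> R by apply: lt_le_trans L1.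
  have n0 : 0 < n%:R :> R by rewrite ltr0n; near: n; exact: nbhs_infty_gt.
  have m1 : 1 < ln (m n)%:R :> R.
    near: n; move/cvgryPgt : (cvg_comp _ _ moo cvg_ln_nat); exact.
  have /andP[mr rm] : (m n)%:R <= r n < (m n).+1%:R by near: n.
  have f0 : 0 < ln n%:R ^+ 2 / n%:R :> R by rewrite divr_gt0 ?exprn_gt0.
  have mn : (m n <= n)%N.
    rewrite -(ler_nat R); apply: (le_trans mr); rewrite ler_pdivrMr ?exprn_gt0//.
    by rewrite ler_peMr ?exprn_ege1// ltW.
  apply/andP; split.
    rewrite -ler_pdivrMr//; apply: le_trans (Qge n).
    rewrite le_eqVlt; apply/orP; left; apply/eqP.
    by field; rewrite !lt0r_neq0.
  rewrite -ler_pdivlMr//; apply: (le_trans (Qle _ _ mn)).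
  rewrite mulrDl lerD//.
    apply: (le_trans mr); rewrite le_eqVlt; apply/orP; left; apply/eqP.
    by rewrite /r; field; rewrite !lt0r_neq0.
  rewrite le_eqVlt; apply/orP; left; apply/eqP.
  by field; rewrite !lt0r_neq0//; lra.
- rewrite [X in _ --> X](_ : _ = 1^-1 * 1^-1); last by rewrite invr1 mulr1.
  by apply: cvgM; (apply: cvgV; [by rewrite oner_eq0|exact: Ycvg]).
- rewrite [X in _ --> X](_ : _ = 0 + 1); last by rewrite add0r.
  by apply: cvgD; [exact: VL|exact: LYm].
Unshelve. all: by end_near. Qed.

End Limits.

Lemma cvg_htwin (R : realType) (alpha : sieve_space) :
  (exists B, forall j,
    (hdev R (hist (2 ^ (j ^ 2)) alpha)) ^+ 2 / j.+1%:R ^+ 2 <= B) ->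
  (exists B, forall j,
    (hmart R (hist (j ^ 4) alpha)) ^+ 2 / j.+1%:R ^+ 6 <= B) ->
  (htwin (hist n alpha))%:R * (ln n%:R ^+ 2 / n%:R) @[n --> \oo] --> (1 : R).
Proof.
move=> /recip_sub_ln_bound /cvg_div_ln_of_sqr_dev Ycvg /mart_bound[C NC].
have L0 n : 0 <= ln n%:R ^+ 2 / n%:R :> R by rewrite divr_ge0 ?sqr_ge0.
have Qcvg : hsquare R (hist n alpha) * (ln n%:R ^+ 2 / n%:R) @[n --> \oo] --> (1 : R).
  apply: (@cvg_sum_inv_sqr _ (fun n => hrecip R (hist n alpha))) => //.
  - by move=> n; rewrite invr_gt0 hweight_gt0.
  - by move=> m n; exact: hrecip_hist_le.
  - move=> n; rewrite /hrecip exprVn invrK.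
    by have := hsquare_ge R (hist n alpha); rewrite size_hist.
  - move=> m n mn; rewrite /hrecip exprVn invrK.
    have [s + sz] := hist_add (n - m) m alpha; rewrite subnK// => ->.
    apply: (le_trans (hsquare_cat_le _ _ _)); rewrite size_hist sz lerD2l.
    by rewrite ler_wpM2r ?sqr_ge0// ler_nat leq_subr.
have Ncvg : hmart R (hist n alpha) * (ln n%:R ^+ 2 / n%:R) @[n --> \oo] --> (0 : R).
  apply: (@cvg0_exprn _ _ _ _ _ 4) => //.
  (* The bound C n^3 on the fourth power, times ((ln n)^2/n)^4, is C (ln n)^8/n. *)
  apply: (@squeeze_cvgr _ _ _ _ (fun=> 0) (fun n => C * (ln n%:R ^+ 8 / n%:R))).
  - near=> n; rewrite exprn_even_ge0//=.
    have n0 : 0 < n%:R :> R by rewrite ltr0n; near: n; exact: nbhs_infty_gt.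
    have -> : C * (ln n%:R ^+ 8 / n%:R) = C * n%:R ^+ 3 * (ln n%:R ^+ 2 / n%:R) ^+ 4.
      by field; rewrite lt0r_neq0.
    rewrite exprMn ler_wpM2r ?exprn_ge0//; apply: le_trans (NC n).
    by rewrite -normrX ler_norm.
  - exact: cvg_cst.
  - rewrite [X in _ --> X](_ : _ = C * 0); last by rewrite mulr0.
    by apply: cvgM; [exact: cvg_cst|exact: cvg_ln_expr_div_nat].
pose D n : R := (htwin (hist n alpha))%:R - hmart R (hist n alpha) - hsquare R (hist n alpha).
have Dcvg : D n * (ln n%:R ^+ 2 / n%:R) @[n --> \oo] --> (0 : R).
  have lim4 c : c * (ln n%:R ^+ 2 / n%:R) @[n --> \oo] --> (0 : R).
    rewrite [X in _ --> X](_ : _ = c * 0); last by rewrite mulr0.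
    by apply: cvgM; [exact: cvg_cst|exact: cvg_ln_expr_div_nat].
  apply: (squeeze_cvgr _ (lim4 (- 4)) (lim4 4)); near=> n.
  by have := htwin_decomp R (hist n alpha); rewrite ler_norml => /andP[? ?]; rewrite !ler_wpM2r.
have -> : (fun n => (htwin (hist n alpha))%:R * (ln n%:R ^+ 2 / n%:R)) =
  (fun n => D n * (ln n%:R ^+ 2 / n%:R) + hmart R (hist n alpha) * (ln n%:R ^+ 2 / n%:R)
     + hsquare R (hist n alpha) * (ln n%:R ^+ 2 / n%:R)).
  by apply/funext => n; rewrite -!mulrDl; congr (_ * _); rewrite /D; ring.
rewrite [X in _ --> X](_ : _ = 0 + 0 + 1); last by rewrite !add0r.
by apply: cvgD; [apply: cvgD; [exact: Dcvg|exact: Ncvg]|exact: Qcvg].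
Unshelve. all: by end_near. Qed.

(** * Counting twins *)

(** For k < 2 position 1 is past the end, and the default [false] is right because [alpha] has no
    element below 2. *)
Lemma nth_hist k (alpha : sieve_space) :
  nth false (hist k alpha) 1 = `[< sieve_set alpha k >].
Proof.
have small m : (m <= 1)%N -> `[< sieve_set alpha m >] = false.
  move=> m1; apply/asboolP => /(set_mem (valP alpha)) /=.
  by rewrite ltnNge m1.
by case: k => [|[|k]] /=; [rewrite small|rewrite small|rewrite addn2].
Qed.

(** The bit appended to a history of size k concerns k + 2 and completes the pair with smaller
    element k, so k bits account for exactly the pairs with j < k. *)
Lemma htwin_hist k (alpha : sieve_space) : htwin (hist k alpha) =
  count (fun j => `[< sieve_set alpha j >] && `[< sieve_set alpha (j + 2)%N >])
    (iota 0 k).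
Proof.
elim: k => // k IH; rewrite -addn1 iotaD count_cat -IH addn1 [LHS]/= nth_hist.
by rewrite /= addn0 andbC.
Qed.

Lemma twin_count_hist (R : realType) (alpha : sieve_space) (x : R) : 0 <= x ->
  twin_count alpha x = htwin (hist (Num.truncn x).+1 alpha).
Proof.
move=> x0; rewrite /twin_count htwin_hist.
set p := (fun j => _ && _); set s := iota _ _.
have -> : fset_set (twin_set alpha x) = [fset j in [seq j <- s | p j]]%fset.
  apply/fsetP => j; rewrite in_fset_set; last exact: finite_twin_set.
  rewrite !inE mem_filter mem_iota /= add0n ltnS truncn_ge_nat//.
  apply/idP/idP => [|/andP[/andP[/asboolP a /asboolP b] c]]; last by rewrite inE.
  by rewrite inE => -[-> a b]; rewrite andbT; apply/andP; split; apply/asboolP.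
rewrite card_fseq undup_id ?size_filter//.
by rewrite filter_uniq// iota_uniq.
Qed.

(** Passage from integers to real x: with k = floor x + 1, both k/x and ln k/ln x tend to 1. *)
Lemma cvg_twin_count (R : realType) (alpha : sieve_space) :
  (htwin (hist n alpha))%:R * (ln n%:R ^+ 2 / n%:R) @[n --> \oo] --> (1 : R) ->
  (twin_count alpha x)%:R / (x / ln x ^+ 2) @[x --> +oo] --> (1 : R).
Proof.
move=> Tcvg; pose k (x : R) := (Num.truncn x).+1.
have kx : \forall x \near +oo, x <= (k x)%:R <= x + 1.
  near=> x; have : 0 <= x by near: x; exact: nbhs_pinfty_ge.
  by move=> /truncn_itv; rewrite /k -[_.+1%:R]natr1 => /andP[]; lra.
have x1 : \forall x \near +oo, 1 < x :> R by exact: nbhs_pinfty_gt.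
have koo : k x @[x --> +oo] --> \oo.
  apply/(@cvgrnyP R); apply/cvgryPge => A; near=> x.
  have /andP[+ _] : x <= (k x)%:R <= x + 1 by near: x.
  apply: le_trans; near: x; apply: nbhs_pinfty_ge; exact: num_real.
have Vx : x^-1 @[x --> +oo] --> (0 : R) by exact: (@cvgV_pinfty R R +oo _ id cvg_id).
have VL := cvgV_pinfty (@cvg_ln_pinfty R).
have kdiv : (k x)%:R / x @[x --> +oo] --> (1 : R).
  apply: (@squeeze_cvgr _ _ _ _ (fun=> 1) (fun x => 1 + x^-1)).
  - near=> x; have x_gt1 : 1 < x by near: x.
    have x0 : 0 < x by apply: lt_trans x_gt1.
    have /andP[a b] : x <= (k x)%:R <= x + 1 by near: x.
    by rewrite ler_pdivlMr// ler_pdivrMr// mulrDl mulVf ?lt0r_neq0// !mul1r a b.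
  - exact: cvg_cst.
  - rewrite [X in _ --> X](_ : _ = 1 + 0); last by rewrite addr0.
    by apply: cvgD; [exact: cvg_cst|exact: Vx].
have lnk : ln (k x)%:R / ln x @[x --> +oo] --> (1 : R).
  apply: (@squeeze_cvgr _ _ _ _ (fun=> 1) (fun x => 1 + ln 2 * (ln x)^-1)).
  - near=> x; have x_gt1 : 1 < x by near: x.
    have x0 : 0 < x by apply: lt_trans x_gt1.
    have L0 := ln_gt0 x_gt1.
    have /andP[a b] : x <= (k x)%:R <= x + 1 by near: x.
    have k0 : 0 < (k x)%:R :> R by apply: lt_le_trans a.
    rewrite ler_pdivlMr// ler_pdivrMr// mulrDl -mulrA mulVf ?lt0r_neq0// mulr1 !mul1r.
    (* The upper bound uses k <= x + 1 <= 2 x, valid since x > 1. *)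
    rewrite ler_ln ?posrE// a/= addrC -lnM ?posrE// ler_ln ?posrE ?mulr_gt0//.
    by lra.
  - exact: cvg_cst.
  - rewrite [X in _ --> X](_ : _ = 1 + ln 2 * 0); last by rewrite mulr0 addr0.
    by apply: cvgD; [exact: cvg_cst|apply: cvgM; [exact: cvg_cst|exact: VL]].
have Tk : (htwin (hist (k x) alpha))%:R * (ln (k x)%:R ^+ 2 / (k x)%:R)
  @[x --> +oo] --> (1 : R) by exact: (cvg_comp _ _ koo Tcvg).
have lim : (htwin (hist (k x) alpha))%:R * (ln (k x)%:R ^+ 2 / (k x)%:R)
   * ((k x)%:R / x) * ((ln (k x)%:R / ln x)^-1 * (ln (k x)%:R / ln x)^-1)
   @[x --> +oo] --> (1 : R).
  rewrite [X in _ --> X](_ : _ = 1 * 1 * (1^-1 * 1^-1)); last by rewrite invr1 !mulr1.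
  apply: cvgM; first by apply: cvgM; [exact: Tk|exact: kdiv].
  by apply: cvgM; (apply: cvgV; [by rewrite oner_eq0|exact: lnk]).
(* Once x > 1, the quantities k, ln k, x and ln x are positive and the correction factors cancel
   exactly. *)
apply: cvg_trans lim; apply: near_eq_cvg; near=> x.
have x_gt1 : 1 < x by near: x.
have x0 : 0 < x by apply: lt_trans x_gt1.
have L0 := ln_gt0 x_gt1.
have /andP[a b] : x <= (k x)%:R <= x + 1 by near: x.
have k1 : 1 < (k x)%:R :> R by apply: lt_le_trans a.
have Lk0 := ln_gt0 k1; have k0 : 0 < (k x)%:R :> R by apply: lt_le_trans a.
rewrite (twin_count_hist _ (ltW x0)) -/(k x).
move: (ln _) (ln _) L0 Lk0 => Lx Lk L0 Lk0.
by move: ((k x)%:R : R) k0 => K k0; field; rewrite !lt0r_neq0.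
Unshelve. all: by end_near. Qed.

Theorem theorem1 (R : realType) (mu : probability sieve_measurableType R)
    (mu_hawkins : is_hawkins_measure mu) :
  {ae mu, forall alpha : sieve_space,
    (twin_count alpha x)%:R / (x / ln x ^+ 2) @[x --> +oo] --> (1 : R)}.
Proof.
apply: (@filterS2 _ _ (ae_filter_ringOfSetsType mu) _ _ _ _
  (ae_dev_bound mu_hawkins) (ae_mart_bound mu_hawkins)).
by move=> alpha dev mart; apply: cvg_twin_count; exact: cvg_htwin.
Qed.
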